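(* Let $\mathfrak g$ be a finite-dimensional real unimodular solvable Lie algebra whose nilradical $\mathfrak n$ is abelian. Then there exists an inner product on $\mathfrak g$ having a geodesic basis.
   Context: For an inner product $\langle\cdot,\cdot\rangle$ on a real Lie algebra $\mathfrak g$, a nonzero $X\in\mathfrak g$ is a geodesic element if $\langle X,[X,Y]\rangle=0$ for all $Y\in\mathfrak g$. A basis of $\mathfrak g$ is a geodesic basis (for that inner product) if each of its elements is a geodesic element. A Lie algebra is unimodular if $\operatorname{Tr}(\operatorname{ad}(X))=0$ for all $X\in\mathfrak g$. The nilradical is the maximal nilpotent ideal. *)

(* Defs.v *)
From HB Require Import structures.
From mathcomp Require Import all_boot all_order all_algebra.
From mathcomp Require Import reals.
Set Implicit Arguments. Unset Strict Implicit. Unset Printing Implicit Defensive.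
Import Order.TTheory GRing.Theory Num.Theory.
Local Open Scope ring_scope.

(* A finite-dimensional real Lie algebra is modelled as R^n = 'rV[R]_n with a
   bracket br.  Subspaces are represented by square matrices (row spaces). *)
Section Lie.
Variables (R : realType) (n : nat).
Implicit Types (br : 'rV[R]_n -> 'rV[R]_n -> 'rV[R]_n).

Definition is_lie_bracket br : Prop :=
  [/\ (forall (a : R) x y z, br (a *: x + y) z = a *: br x z + br y z),
      (forall (a : R) x y z, br x (a *: y + z) = a *: br x y + br x z),
      (forall x, br x x = 0) &
      (forall x y z, br x (br y z) + br y (br z x) + br z (br x y) = 0)].

(* matrix of ad x (row convention: row i is the image of the i-th basis vector) *)
Definition ad_mx br (x : 'rV[R]_n) : 'M[R]_n :=
  \matrix_(i < n, j < n) (br x (delta_mx 0 i)) 0 j.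

Definition unimodular br : Prop := forall x, \tr (ad_mx br x) = 0.

Definition brsp br (A B : 'M[R]_n) : 'M[R]_n :=
  (\sum_(i < n) \sum_(j < n) <<br (row i A) (row j B)>>)%MS.

Fixpoint derived br (k : nat) : 'M[R]_n :=
  if k is k'.+1 then brsp br (derived br k') (derived br k') else 1%:M.

Definition solvable_lie br : Prop := exists k, derived br k = 0.

Definition is_ideal br (I : 'M[R]_n) : Prop :=
  forall x y, (y <= I)%MS -> (br x y <= I)%MS.

Fixpoint lcs br (I : 'M[R]_n) (k : nat) : 'M[R]_n :=
  if k is k'.+1 then brsp br I (lcs br I k') else I.

Definition nilpotent_sub br (I : 'M[R]_n) : Prop := exists k, lcs br I k = 0.

Definition is_nilradical br (N : 'M[R]_n) : Prop :=
  [/\ is_ideal br N, nilpotent_sub br N &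
      forall M, is_ideal br M -> nilpotent_sub br M -> (N <= M)%MS -> (M <= N)%MS].

Definition abelian_sub br (N : 'M[R]_n) : Prop :=
  forall x y, (x <= N)%MS -> (y <= N)%MS -> br x y = 0.

Definition is_inner_product (ip : 'rV[R]_n -> 'rV[R]_n -> R) : Prop :=
  [/\ (forall (a : R) x y z, ip (a *: x + y) z = a * ip x z + ip y z),
      (forall x y, ip x y = ip y x) &
      (forall x, x != 0 -> 0 < ip x x)].

Definition geodesic_element br (ip : 'rV[R]_n -> 'rV[R]_n -> R) (X : 'rV[R]_n) : Prop :=
  X != 0 /\ forall Y, ip X (br X Y) = 0.

Definition geodesic_basis br ip (B : 'M[R]_n) : Prop :=
  [/\ row_free B, row_full B & forall i, geodesic_element br ip (row i B)].

End Lie.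

(* Main.v *)
Require Import Defs.
From HB Require Import structures.
From mathcomp Require Import all_boot all_order all_algebra.
From mathcomp Require Import reals boolp complex spectral ring.
Set Implicit Arguments. Unset Strict Implicit. Unset Printing Implicit Defensive.
Import Order.TTheory GRing.Theory Num.Theory.
Local Open Scope ring_scope.

(** Let [n] be a maximal nilpotent ideal, which is abelian by hypothesis.  A
    trace argument puts [D = [g, g]] inside [n]: if the (k+1)-st derived algebra
    lies in [n] and [k >= 1], then first [[g, D^k]] and then [D^k] act on [n] by
    commuting matrices all of whose powers have trace zero, so both generate
    with [n] a nilpotent ideal.  Hence [D] is abelian, and [g] acts on [D] by
    commuting matrices, of trace zero because [g] is unimodular.

    For commuting real matrices, [D] splits into invariant subspaces [V_k], each
    with a basis in which every matrix of the family has constant diagonal.  In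
    the inner product making these bases orthonormal, every vector
    [v = sum_k (+/-) sqrt (dim V_k) e_k], with [e_k] a basis vector of [V_k],
    satisfies [<v, A v> = tr A = 0], and such vectors span [D].  Extending the
    inner product to [g] by an orthogonal complement of [D], all vectors of that
    complement are geodesic because brackets lie in [D]. *)

(** * Linear algebra *)

Section LinearAlgebra.
Variable F : fieldType.

(* The projection on the Fitting component where [T] is invertible is a polynomial
   in [T] without constant term. *)
Lemma fitting_idempotent n (T : 'M[F]_n) :
  exists2 p : {poly F}, let e := \sum_(j < size p) p`_j *: T ^+ j.+1 in e *m e = e
    & exists k, T ^+ k *m (1%:M - \sum_(j < size p) p`_j *: T ^+ j.+1) = 0.
Proof.
case: n T => [|n] T.
  by exists 0 => [|]; [exact: (etrans (thinmx0 _) (esym (thinmx0 _))) | exists 0%N; exact: thinmx0].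
have [k [q]] := multiplicity_XsubC (char_poly T) 0.
rewrite monic_neq0 ?char_poly_monic //= subr0 => q0 chiE.
(* Here [char_poly T = q * 'X^k] with [q] prime to ['X]. Using [k.+1] instead of [k] leaves the
   Bezout term [u * 'X^(k.+1)] without constant coefficient even when [k = 0]. *)
have /Bezout_eq1_coprimepP [[u v] /= uv1] : coprimep ('X^(k.+1)) q.
  by rewrite coprimep_expl // coprimep_sym -['X]subr0 -polyC0 coprimep_XsubC.
have hornerXE : horner_mx T (u * 'X^(k.+1)) =
    \sum_(j < size (u * 'X^k)) (u * 'X^k)`_j *: T ^+ j.+1.
  rewrite exprSr mulrA -{1}[u * 'X^k]coefK poly_def mulr_suml linear_sum /=.
  by apply: eq_bigr => j _; rewrite -scalerAl -exprSr linearZ /= rmorphXn /= horner_mx_X.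
have chi0 : horner_mx T (q * 'X^k) = 0 by rewrite -chiE Cayley_Hamilton.
have eC : 1%:M - horner_mx T (u * 'X^(k.+1)) = horner_mx T (v * q).
  by rewrite -[1%:M](rmorph1 (horner_mx T)) -uv1 rmorphD /= addrC addKr.
exists (u * 'X^k) => /=; last first.
  exists k; rewrite -hornerXE eC -{1}(horner_mx_X T) -rmorphXn /= mulmxE -rmorphM /=.
  by rewrite mulrCA ['X^k * q]mulrC rmorphM /= chi0 mulr0.
rewrite -hornerXE; apply/eqP; rewrite -subr_eq0 -opprB oppr_eq0.
rewrite -{1}[horner_mx T _]mulmx1 -mulmxBr eC mulmxE -rmorphM /=.
have -> : u * 'X^(k.+1) * (v * q) = u * v * 'X * (q * 'X^k) by rewrite exprS; ring.
by rewrite rmorphM /= chi0 mulr0.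
Qed.

(** Both factors of the rank factorization can be cancelled in [e *m e = e]. *)
Lemma idempotent_base n (e : 'M[F]_n) :
  e *m e = e -> row_base e *m col_base e = 1%:M.
Proof.
move=> ee; apply: (row_free_inj (row_base_free e)).
apply: (row_full_inj (col_base_full e)).
by rewrite mul1mx -mulmxA mulmx_base mulmxA mulmx_base ee.
Qed.

Lemma trace_idempotent n (e : 'M[F]_n) : e *m e = e -> \tr e = (\rank e)%:R.
Proof.
by move=> ee; rewrite -{1}(mulmx_base e) mxtrace_mulC idempotent_base // mxtrace1.
Qed.

Lemma size_invertible m n (E : 'M[F]_(m, n)) (G : 'M[F]_(n, m)) :
  E *m G = 1%:M -> G *m E = 1%:M -> m = n.
Proof.
have le p q (X : 'M[F]_(p, q)) Y : X *m Y = 1%:M -> (p <= q)%N.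
  by move=> XY; rewrite -(mxrank1 F p) -XY (leq_trans (mxrankM_maxl _ _)) ?rank_leq_col.
by move=> /le mn /le nm; apply/eqP; rewrite eqn_leq mn nm.
Qed.

(** The complement comes from the rank factorization of the idempotent [1%:M - C *m W]. *)
Lemma complete_section d n (W : 'M[F]_(d, n)) (C : 'M[F]_(n, d)) :
  W *m C = 1%:M ->
  exists m (W' : 'M[F]_(m, n)) (C' : 'M[F]_(n, m)), (d + m)%N = n /\
  [/\ C *m W + C' *m W' = 1%:M, W' *m C' = 1%:M, W *m C' = 0 & W' *m C = 0].
Proof.
move=> WC; set f := 1%:M - C *m W.
have Wf : W *m f = 0 by rewrite mulmxBr mulmx1 mulmxA WC mul1mx subrr.
have fC : f *m C = 0 by rewrite mulmxBl mul1mx -mulmxA WC mulmx1 subrr.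
have ff : f *m f = f by rewrite {1}/f mulmxBl mul1mx -mulmxA Wf mulmx0 subr0.
exists (\rank f), (row_base f), (col_base f).
have CW : C *m W + col_base f *m row_base f = 1%:M by rewrite mulmx_base addrC subrK.
have W'C' := idempotent_base ff.
have WC' : W *m col_base f = 0.
  by apply: (row_free_inj (row_base_free f)); rewrite -mulmxA mulmx_base Wf mul0mx.
have W'C : row_base f *m C = 0.
  by apply: (row_full_inj (col_base_full f)); rewrite mulmxA mulmx_base fC mulmx0.
split=> //; apply: (@size_invertible _ _ (col_mx W (row_base f)) (row_mx C (col_base f))).
  by rewrite mul_col_row WC WC' W'C W'C' -scalar_mx_block.
by rewrite mul_row_col.
Qed.

(** The Fitting idempotent is a combination of the powers [T ^+ j.+1], so its trace, which is its
    rank, vanishes; in characteristic zero the idempotent is then zero. *)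
Lemma nilpotent_of_traces n (T : 'M[F]_n) : [pchar F] =i pred0 ->
  (forall j, \tr (T ^+ j.+1) = 0) -> exists k, T ^+ k = 0.
Proof.
move=> char0 trT; have [p /= ee [k Tk]] := fitting_idempotent T.
set e := \sum_(j < _) _ in ee Tk.
have : \tr e = 0.
  by rewrite linear_sum big1 //= => j _; rewrite linearZ /= trT mulr0.
rewrite trace_idempotent // => /eqP; rewrite ((pcharf0P _).1 char0) mxrank_eq0 => /eqP e0.
by exists k; move: Tk; rewrite e0 subr0 mulmx1.
Qed.

(** Induction on the number of matrices. If [L *m X i ^+ k.+1 = 0], multiplying the inclusion by
    [X i ^+ k] removes the term of index [i], so the induction hypothesis gives [L *m X i ^+ k = 0];
    descend to [k = 0]. *)
Lemma commuting_nilpotent_eq0 n (I : finType) (X : I -> 'M[F]_n) :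
  (forall i j, comm_mx (X i) (X j)) -> (forall i, exists k, X i ^+ k = 0) ->
  forall (P : {set I}) m (L : 'M[F]_(m, n)),
  (L <= \sum_(i in P) <<L *m X i>>)%MS -> L = 0.
Proof.
move=> XC Xnil P; elim: {P}#|P| {-2}P (leqnn #|P|) => [|c IHc] P cP m L LP.
  move: cP LP; rewrite leqn0 cards_eq0 => /eqP ->.
  by rewrite big_set0 submx0 => /eqP.
have [P0 | [i iP]] := set_0Vmem P.
  by move: LP; rewrite P0 big_set0 submx0 => /eqP.
have [k Xk] := Xnil i.
have : L *m X i ^+ k = 0 by rewrite Xk mulmx0.
elim: k {Xk} => [|k IHk]; first by rewrite mulmx1.
move=> Lk; apply: IHk; apply: (IHc (P :\ i)).
  by rewrite (cardsD1 i) iP in cP.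
have := submxMr (X i ^+ k) LP; move/submx_trans; apply.
rewrite sumsmxMr_gen; apply/sumsmx_subP => j jP; rewrite genmxE.
have -> : (<<L *m X j>> *m X i ^+ k :=: L *m X i ^+ k *m X j)%MS.
  apply: eqmx_trans (eqmxMr _ (genmxE _)) _.
  have cji : X j *m X i ^+ k = X i ^+ k *m X j := commrX k (XC j i).
  by rewrite -!mulmxA cji.
have [->|ji] := eqVneq j i; first by rewrite -mulmxA mulmxE -exprSr Lk sub0mx.
by apply: (sumsmx_sup j); rewrite ?genmxE // !inE ji.
Qed.

Lemma stationary_chain n (f : nat -> 'M[F]_n) :
  (forall k, (f k.+1 <= f k)%MS) -> exists k, (f k <= f k.+1)%MS.
Proof.
move=> fS; apply: contrapT => nex.
have : forall k, (\rank (f k) + k <= n)%N.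
  elim=> [|k]; first by rewrite addn0 rank_leq_col.
  move=> IH; apply: leq_trans IH; rewrite addnS ltn_add2r.
  have : (f k.+1 < f k)%MS by rewrite ltmxE fS; apply/negP => H; apply: nex; exists k.
  exact: rank_ltmx.
by move/(_ n.+1); rewrite addnS ltnNge leq_addl.
Qed.

(** Greedy choice: fewer than [n] rows are all killed by some nonzero [u0], and a vector of [S] not
    killed by [u0] is independent of them. *)
Lemma free_rows_in_spanning n (S : 'rV[F]_n -> Prop) :
  (forall u : 'cV[F]_n, (forall v, S v -> v *m u = 0) -> u = 0) ->
  forall k, (k <= n)%N -> exists2 B : 'M[F]_(k, n), row_free B & forall i, S (row i B).
Proof.
move=> Sspan; elim=> [|k IHk] kn.
  by exists 0 => [|[]//]; rewrite /row_free mxrank0.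
have [B Bfree BS] := IHk (ltnW kn).
have [u0 Bu u0n] : exists2 u : 'cV[F]_n, B *m u = 0 & u != 0.
  have : kermx B^T != 0.
    by rewrite kermx_eq0 /row_free mxrank_tr (eqP Bfree) neq_ltn kn.
  case/rowV0Pn => v; rewrite sub_kermx => /eqP vB v0; exists v^T.
    by apply: trmx_inj; rewrite trmx_mul trmxK vB trmx0.
  by rewrite -trmx0 (inj_eq trmx_inj).
have [v Sv vu] : exists2 v, S v & v *m u0 != 0.
  apply: contrapT => nex; move/eqP: u0n; apply; apply: Sspan => v Sv.
  by apply/eqP/negPn/negP => vu; apply: nex; exists v.
rewrite -(addn1 k); exists (col_mx B v) => [|i].
  rewrite -kermx_eq0; apply/rowV0P => w; rewrite sub_kermx -[w]hsubmxK mul_row_col.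
  set w1 := lsubmx w; set w2 := rsubmx w => /eqP wB.
  have w20 : w2 = 0.
    have := congr1 (mulmx^~ u0) wB; rewrite /= mulmxDl mul0mx -!mulmxA Bu mulmx0 add0r.
    rewrite [w2]mx11_scalar mul_scalar_mx => /eqP; rewrite scaler_eq0 (negPf vu) orbF.
    by move/eqP->; rewrite raddf0.
  move: wB; rewrite w20 mul0mx addr0 => /eqP; rewrite mulmx_free_eq0 // => /eqP->.
  exact: row_mx0.
rewrite -(splitK i); case: split => j /=.
  by rewrite rowKu.
by rewrite rowKd ord1 row_id.
Qed.

End LinearAlgebra.

(** * Commuting families of real matrices *)

Section CommutingFamilies.
Variables (R : realType) (I : finType).

(** Take the real and imaginary parts of a common complex eigenvector [x + i y], with eigenvalues
    [a + i b]. They may be dependent, so the plane may be a line. *)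
Lemma common_invariant_plane n (A : I -> 'M[R]_n) : (0 < n)%N ->
  (forall i j, comm_mx (A i) (A j)) ->
  exists (x y : 'rV[R]_n) (a b : I -> R), col_mx x y != 0 /\
    forall i, x *m A i = a i *: x - b i *: y /\ y *m A i = b i *: x + a i *: y.
Proof.
move=> n_gt0 AC; pose AsC := [seq map_mx (real_complex R) (A i) | i <- enum I].
have [|v v0 /allP vA] := @common_eigenvector (R[i] : numClosedFieldType) n AsC n_gt0.
  move=> _ _ /mapP[i _ ->] /mapP[j _ ->].
  by rewrite /comm_mx -!map_mxM AC.
have /choice[l vl] : forall i, exists l, v *m map_mx (real_complex R) (A i) = l *: v.
  by move=> i; apply/sub_rVP/vA/map_f; rewrite mem_enum.
exists (map_mx (@complex.Re R) v), (map_mx (@complex.Im R) v).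
exists (fun i => complex.Re (l i)), (fun i => complex.Im (l i)); split.
  apply: contra_neq v0; rewrite -col_mx0 => /eq_col_mx[/matrixP re0 /matrixP im0].
  apply/matrixP => i j; move: (re0 i j) (im0 i j); rewrite !mxE.
  by case: (v i j) => ? ? /= -> ->.
move=> i; split; apply/matrixP => k j; have /matrixP/(_ k j) := vl i; rewrite !mxE.
  move/(congr1 (@complex.Re R)); rewrite raddf_sum /=.
  have -> : complex.Re (l i * v k j) =
     complex.Re (l i) * complex.Re (v k j) - complex.Im (l i) * complex.Im (v k j).
    by case: (l i) (v k j) => ? ? [].
  move=> <-; apply: eq_bigr => h _; rewrite !mxE.
  by case: (v k h) => ? ?; rewrite /= mulr0 subr0.
move/(congr1 (@complex.Im R)); rewrite raddf_sum /=.
have -> : complex.Im (l i * v k j) =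
   complex.Im (l i) * complex.Re (v k j) + complex.Re (l i) * complex.Im (v k j).
  by case: (l i) (v k j) => ? ? [] ? ? /=; rewrite addrC.
move=> <-; apply: eq_bigr => h _; rewrite !mxE.
by case: (v k h) => ? ?; rewrite /= mulr0 add0r.
Qed.

Lemma nilpotent_stable_eq0 n (T : 'M[R]_n) k m (V : 'M[R]_(m, n)) :
  T ^+ k = 0 -> (V <= V *m T)%MS -> V = 0.
Proof.
move=> Tk VT; have : (V <= V *m T ^+ k)%MS.
  elim: k {Tk} => [|k IH]; first by rewrite expr0 mulmx1.
  by rewrite exprSr -mulmxE mulmxA (submx_trans VT) // submxMr.
by rewrite Tk mulmx0 => /submx0null.
Qed.

(** The rows of [E] form a basis in which the whole family has zero diagonal. The size [m],
    necessarily [n], is left free so that bases can be stacked without casts. *)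
Definition diag_free n (A : I -> 'M[R]_n) :=
  exists m (E : 'M[R]_(m, n)) (F : 'M[R]_(n, m)),
    [/\ E *m F = 1%:M, F *m E = 1%:M & forall i j, (E *m A i *m F) j j = 0].

(** In the basis made of [W] and a lift of a basis of the quotient, each [A i] is block triangular,
    with [B i] and the quotient matrix as diagonal blocks. *)
Lemma diag_free_extend d n (A : I -> 'M[R]_n) (B : I -> 'M[R]_d)
    (W : 'M[R]_(d, n)) (C : 'M[R]_(n, d))
    m (W' : 'M[R]_(m, n)) (C' : 'M[R]_(n, m)) :
  W *m C = 1%:M -> (forall i, W *m A i = B i *m W) -> (forall i j, B i j j = 0) ->
  [/\ C *m W + C' *m W' = 1%:M, W' *m C' = 1%:M, W *m C' = 0 & W' *m C = 0] ->
  diag_free (fun i => W' *m A i *m C') -> diag_free A.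
Proof.
move=> WC WA B0 [CW W'C' WC' W'C] [q [E [F [EF FE EAF]]]].
exists (d + q)%N, (col_mx W (E *m W')), (row_mx C (C' *m F)); split.
- rewrite mul_col_row WC mulmxA WC' mul0mx -(mulmxA E) W'C mulmx0.
  by rewrite mulmxA -(mulmxA E) W'C' mulmx1 EF -scalar_mx_block.
- by rewrite mul_row_col mulmxA -(mulmxA C' F) FE mulmx1.
move=> i j; rewrite mul_col_mx mul_col_row -(splitK j); case: split => k /=.
  by rewrite block_mxEul WA -mulmxA WC mulmx1 B0.
rewrite block_mxEdr.
have -> : E *m W' *m A i *m (C' *m F) = E *m (W' *m A i *m C') *m F by rewrite !mulmxA.
exact: EAF.
Qed.

(** The last hypothesis says that all eigenvalues of [A i] are square roots of [- c i], hence purely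
    imaginary. On a common invariant plane or line the diagonal is then zero, and induction handles
    the quotient. *)
Lemma diag_free_of_imaginary n (A : I -> 'M[R]_n) (c : I -> R) :
  (forall i j, comm_mx (A i) (A j)) -> (forall i, 0 <= c i) ->
  (forall i, exists k, (A i *m A i + (c i)%:M) ^+ k = 0) -> diag_free A.
Proof.
elim/ltn_ind: n A => n IHn A AC c0 Anil.
have [n0|n_gt0] := posnP n.
  exists n, 1%:M, 1%:M; split; rewrite ?mulmx1 //.
  by move=> i j; have := ltn_ord j; rewrite {2}n0.
have step d (B : I -> 'M[R]_d) (W : 'M[R]_(d, n)) : (0 < d)%N -> row_free W ->
    (forall i, W *m A i = B i *m W) -> (forall i j, B i j j = 0) -> diag_free A.
  move=> d_gt0 Wfree WA B0; have WC := mulmxVp Wfree.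
  have [m [W' [C' [dm secW]]]] := complete_section WC.
  apply: (diag_free_extend WC WA B0 secW); case: secW => CW W'C' WC' W'C.
  have WAC' i : W *m A i *m C' = 0 by rewrite WA -mulmxA WC' mulmx0.
  have quotM X Y : W *m Y *m C' = 0 ->
      W' *m X *m C' *m (W' *m Y *m C') = W' *m (X *m Y) *m C'.
    move=> WY; have C'W' : C' *m W' = 1%:M - pinvmx W *m W by rewrite -CW addrAC subrr add0r.
    rewrite -mulmxA [C' *m _]mulmxA [C' *m _]mulmxA C'W' mulmxBl mul1mx mulmxBl.
    by rewrite -!(mulmxA (pinvmx W)) WY mulmx0 subr0 !mulmxA.
  apply: IHn => //.
  - by rewrite -dm -[X in (X < _)%N]add0n ltn_add2r.
  - by move=> i j; rewrite /comm_mx !quotM // AC.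
  move=> i; have [k Tk] := Anil i; exists k.
  set T := A i *m A i + _ in Tk.
  have WT : W *m T *m C' = 0.
    rewrite mulmxDr mulmxDl mulmxA {1}WA -!(mulmxA (B i)) WAC' mulmx0 add0r.
    by rewrite mul_mx_scalar -scalemxAl WC' scaler0.
  have -> : W' *m A i *m C' *m (W' *m A i *m C') + (c i)%:M = W' *m T *m C'.
    rewrite quotM // mulmxDr mulmxDl mul_mx_scalar -scalemxAl W'C'.
    by rewrite scalemx1.
  have -> : (W' *m T *m C') ^+ k = W' *m (T ^+ k) *m C'.
    elim: k {Tk} => [|k IH]; first by rewrite !expr0 mulmx1 W'C'.
    by rewrite exprSr IH -mulmxE quotM // exprSr -mulmxE.
  by rewrite Tk mulmx0 mul0mx.
have [x [y [a [b [xy0 xyA]]]]] := common_invariant_plane n_gt0 AC.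
set V := col_mx x y in xy0.
have VA i : V *m A i = block_mx (a i)%:M (- (b i))%:M (b i)%:M (a i)%:M *m V.
  have [xA yA] := xyA i.
  by rewrite mul_col_mx mul_block_col xA yA !mul_scalar_mx scaleNr.
have a0 i : a i = 0.
  have [k Tk] := Anil i.
  (* [p + i q] is [(a + i b) ^ 2 + c], the scalar by which [T] acts on the plane. Were it nonzero,
     [T] would be invertible there, against nilpotence. *)
  pose p := a i ^+ 2 - b i ^+ 2 + c i; pose q := a i * b i *+ 2.
  have [xA yA] := xyA i.
  set T := A i *m A i + _ in Tk.
  have xT : x *m T = p *: x - q *: y.
    rewrite mulmxDr mulmxA xA mulmxBl -!scalemxAl xA yA mul_mx_scalar.
    by apply/matrixP => s t; rewrite !mxE /p /q; ring.
  have yT : y *m T = q *: x + p *: y.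
    rewrite mulmxDr mulmxA yA mulmxDl -!scalemxAl xA yA mul_mx_scalar.
    by apply/matrixP => s t; rewrite !mxE /p /q; ring.
  have s0 : p ^+ 2 + q ^+ 2 = 0.
    apply: contra_neq_eq xy0 => s0; apply: (nilpotent_stable_eq0 Tk); clearbody p q.
    have xE : x = (p / (p ^+ 2 + q ^+ 2)) *: (x *m T) + (q / (p ^+ 2 + q ^+ 2)) *: (y *m T).
      by rewrite xT yT; apply/matrixP => s t; rewrite !mxE; field.
    have yE : y = (p / (p ^+ 2 + q ^+ 2)) *: (y *m T) - (q / (p ^+ 2 + q ^+ 2)) *: (x *m T).
      by rewrite xT yT; apply/matrixP => s t; rewrite !mxE; field.
    rewrite /V mul_col_mx; set x' := x *m T in xE yE *; set y' := y *m T in xE yE *.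
    have x'V : (x' <= col_mx x' y')%MS by rewrite -addsmxE addsmxSl.
    have y'V : (y' <= col_mx x' y')%MS by rewrite -addsmxE addsmxSr.
    rewrite col_mx_sub xE yE -scaleNr.
    by rewrite !addmx_sub ?scalemx_sub.
  move/eqP: s0; rewrite paddr_eq0 ?sqr_ge0 // !sqrf_eq0 /q mulrn_eq0 /= mulf_eq0.
  case/andP=> /eqP p0 /orP[/eqP //|/eqP b0]; apply/eqP.
  have : a i ^+ 2 + c i == 0 by rewrite -p0 /p b0 expr0n subr0.
  by rewrite paddr_eq0 ?sqr_ge0 // sqrf_eq0 => /andP[].
(* When [x] and [y] are dependent they span a line on which [A i] acts by a real scalar [t i], and
   [t i ^+ 2 + c i = 0] forces [t i = 0]. *)
have [Vfree|Vnfree] := boolP (row_free V).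
  apply: (step _ _ V) Vfree VA _ => // i j; rewrite -(splitK j) a0.
  by case: split => k /=; rewrite ?block_mxEul ?block_mxEdr mxE mul0rn.
pose z := nz_row V.
have z0 : z != 0 by rewrite nz_row_eq0.
have zV : (V <= z)%MS.
  rewrite -(geq_leqif (mxrank_leqif_sup (nz_row_sub V))) rank_rV z0.
  rewrite -ltnS ltn_neqAle rank_leq_row andbT.
  exact: Vnfree.
have /choice[t zA] : forall i, exists t, z *m A i = t *: z.
  move=> i; apply/sub_rVP; apply: submx_trans zV.
  by apply: submx_trans (submxMr _ (nz_row_sub V)) _; rewrite VA submxMl.
apply: (step _ (fun i => (t i)%:M) z) => //; first by rewrite /row_free rank_rV z0.
  by move=> i; rewrite mul_scalar_mx.
move=> i j; rewrite ord1 mxE mulr1n; have [k Tk] := Anil i.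
have zT : z *m (A i *m A i + (c i)%:M) = (t i ^+ 2 + c i) *: z.
  by rewrite mulmxDr mulmxA zA -scalemxAl zA mul_mx_scalar scalerA -scalerDl.
have /eqP : t i ^+ 2 + c i = 0.
  apply: contra_neq_eq z0 => s0; apply: (nilpotent_stable_eq0 Tk).
  by rewrite zT eqmx_scale.
by rewrite paddr_eq0 ?sqr_ge0 // sqrf_eq0 => /andP[/eqP].
Qed.

(** * Inner products whose trace vectors span *)

Definition posdef n (G : 'M[R]_n) :=
  G^T = G /\ forall x : 'rV[R]_n, x != 0 -> 0 < (x *m G *m x^T) 0 0.

(** Prescribing the value [\tr (A i)] instead of zero makes the notion additive over orthogonal
    invariant decompositions, whose pieces need not have trace zero. *)
Definition trace_vector n (A : I -> 'M[R]_n) (G : 'M[R]_n) (v : 'rV[R]_n) :=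
  forall i, v *m A i *m G *m v^T = (\tr (A i))%:M.

(* The trace vectors span; stating this by duality avoids choosing a basis among them. *)
Definition balanced n (A : I -> 'M[R]_n) :=
  exists2 G, posdef G &
    forall u : 'cV[R]_n, (forall v, trace_vector A G v -> v *m u = 0) -> u = 0.

Lemma gram_gt0 n (x : 'rV[R]_n) : x != 0 -> 0 < (x *m x^T) 0 0.
Proof.
have -> : (x *m x^T) 0 0 = \sum_j x 0 j ^+ 2.
  by rewrite mxE; apply: eq_bigr => j _; rewrite mxE expr2.
move=> x0; rewrite lt_neqAle sumr_ge0 ?andbT => [|j _]; last exact: sqr_ge0.
apply: contra_neq x0 => /esym s0; apply/rowP => j; rewrite mxE; apply/eqP.
rewrite -sqrf_eq0; apply/eqP/(psumr_eq0P _ s0) => // i _; exact: sqr_ge0.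
Qed.

(** The Gram matrix [F *m F^T] makes the rows of [E] orthonormal. Each row pairs with its image to
    [a i], while the trace is [m] times [a i]; so the rows scaled by [Num.sqrt m%:R] are trace
    vectors. *)
Lemma balanced_of_diag n (A : I -> 'M[R]_n) (a : I -> R) :
  diag_free (fun i => A i - (a i)%:M) -> balanced A.
Proof.
case=> m [E [F [EF FE EAF]]].
have FE' : F^T *m E^T = 1%:M by rewrite -trmx_mul EF trmx1.
have diagE i j : (E *m A i *m F) j j = a i.
  have := EAF i j; rewrite mulmxBr mulmxBl mul_mx_scalar -scalemxAl EF scalemx1.
  move: (E *m A i *m F) => B.
  by rewrite !mxE eqxx mulr1n => /eqP; rewrite subr_eq0 => /eqP.
have trA i : \tr (A i) = a i *+ m.
  rewrite -[A i]mul1mx -FE -mulmxA mxtrace_mulC /mxtrace (eq_bigr (fun=> a i)).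
    by rewrite sumr_const card_ord.
  by move=> j _; rewrite diagE.
exists (F *m F^T) => [|u Su].
  split=> [|x x0]; first by rewrite trmx_mul trmxK.
  have -> : x *m (F *m F^T) *m x^T = (x *m F) *m (x *m F)^T by rewrite trmx_mul !mulmxA.
  apply: gram_gt0; apply: contra_neq x0 => xF.
  by rewrite -[x]mulmx1 -FE mulmxA xF mul0mx.
rewrite -[u]mul1mx -FE -mulmxA.
suff -> : E *m u = 0 by rewrite mulmx0.
apply/row_matrixP => j; rewrite row0 row_mul.
have m_gt0 : 0 < m%:R :> R by rewrite ltr0n (leq_ltn_trans _ (ltn_ord j)).
have sq0 : Num.sqrt m%:R != 0 :> R by rewrite gt_eqF // sqrtr_gt0.
have : Num.sqrt m%:R *: row j E *m u = 0.
  apply: Su => i; rewrite linearZ /= -!scalemxAl -scalemxAr scalerA -expr2.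
  rewrite sqr_sqrtr ?ltW //.
  have -> : row j E *m A i *m (F *m F^T) *m (row j E)^T = col j (row j (E *m A i *m F)).
    by rewrite tr_row !colE !mulmxA -(mulmxA _ F^T) FE' mulmx1 !row_mul.
  rewrite trA [X in _ *: X]mx11_scalar scale_scalar_mx mxE mxE diagE.
  by rewrite mulr_natl.
by rewrite -scalemxAl => /eqP; rewrite scaler_eq0 (negPf sq0) => /eqP.
Qed.

(** In the orthogonal sum of the two inner products, a trace vector of one component plus or minus
    one of the other is a trace vector, because traces add. *)
Lemma balanced_split n (A : I -> 'M[R]_n) r1 r2
    (W1 : 'M[R]_(r1, n)) (C1 : 'M[R]_(n, r1))
    (W2 : 'M[R]_(r2, n)) (C2 : 'M[R]_(n, r2)) : (0 < r1)%N -> (0 < r2)%N ->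
  W1 *m C1 = 1%:M -> C1 *m W1 + C2 *m W2 = 1%:M ->
  W2 *m C2 = 1%:M -> W1 *m C2 = 0 -> W2 *m C1 = 0 ->
  (forall i, W1 *m A i *m C2 = 0) -> (forall i, W2 *m A i *m C1 = 0) ->
  balanced (fun i => W1 *m A i *m C1) -> balanced (fun i => W2 *m A i *m C2) ->
  balanced A.
Proof.
move=> r1_gt0 r2_gt0 WC1 CW WC2 WC12 WC21 A12 A21 [G1 [G1s G1p] S1] [G2 [G2s G2p] S2].
have formE (x y : 'rV[R]_n) : x *m (C1 *m G1 *m C1^T + C2 *m G2 *m C2^T) *m y^T =
    x *m C1 *m G1 *m (y *m C1)^T + x *m C2 *m G2 *m (y *m C2)^T.
  by rewrite mulmxDr mulmxDl !trmx_mul !mulmxA.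
(* Each component needs one trace vector to pair with those of the other; a spanning set of a
   nonzero space is nonempty. *)
have witness r (B : I -> 'M[R]_r) G : (0 < r)%N ->
    (forall u : 'cV[R]_r, (forall v, trace_vector B G v -> v *m u = 0) -> u = 0) ->
    exists v, trace_vector B G v.
  case: r B G => // r B G _ S; apply: contrapT => nex.
  have /matrixP/(_ 0 0)/eqP : const_mx 1 = 0 :> 'cV[R]_r.+1.
    by apply: S => v Bv; case: nex; exists v.
  by rewrite !mxE oner_eq0.
have [w1 Tw1] := witness _ _ _ r1_gt0 S1.
have [w2 Tw2] := witness _ _ _ r2_gt0 S2.
exists (C1 *m G1 *m C1^T + C2 *m G2 *m C2^T) => [|u Su].
  split=> [|x x0]; first by rewrite linearD /= !trmx_mul !trmxK G1s G2s !mulmxA.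
  have p1 := G1p (x *m C1); have p2 := G2p (x *m C2).
  rewrite formE mxE.
  have [x10|x10] := eqVneq (x *m C1) 0; last first.
    have [->|x20] := eqVneq (x *m C2) 0; last by rewrite addr_gt0 ?p1 ?p2.
    by rewrite !mul0mx [X in _ + X]mxE addr0 p1.
  rewrite x10 !mul0mx [X in X + _]mxE add0r p2 //; apply: contra_neq x0 => x20.
  by rewrite -[x]mulmx1 -CW mulmxDr !mulmxA x10 x20 !mul0mx addr0.
have good (s : R) v1 v2 : s ^+ 2 = 1 ->
    trace_vector (fun i => W1 *m A i *m C1) G1 v1 ->
    trace_vector (fun i => W2 *m A i *m C2) G2 v2 ->
    v1 *m (W1 *m u) + s *: (v2 *m (W2 *m u)) = 0.
  move=> s2 T1 T2; rewrite !mulmxA scalemxAl -mulmxDl; apply: Su => i.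
  rewrite formE !mulmxDl -!scalemxAl.
  have -> : v1 *m W1 *m A i *m C2 = 0 by rewrite -!mulmxA [W1 *m _]mulmxA A12 mulmx0.
  have -> : v2 *m W2 *m A i *m C1 = 0 by rewrite -!mulmxA [W2 *m _]mulmxA A21 mulmx0.
  rewrite -!(mulmxA v1) -!(mulmxA v2) WC1 WC2 WC12 WC21 !mulmx1 !mulmx0 !scaler0 addr0 !add0r.
  rewrite !mul0mx scaler0 addr0 add0r linearZ /= -!scalemxAr scalerA -expr2 s2 scale1r.
  have := T1 i; have := T2 i; rewrite !mulmxA => -> ->.
  rewrite -raddfD /=; congr (_%:M).
  rewrite -!(mulmxA _ (A i)) mxtrace_mulC -mulmxA.
  rewrite [in X in _ + X]mxtrace_mulC -mulmxA -linearD /= -mulmxDr.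
  by rewrite CW mulmx1.
(* Both signs are needed: they separate the two components of [u]. *)
have good1 v1 v2 T1 T2 := good 1 v1 v2 (expr1n _ _) T1 T2.
have good2 v1 v2 T1 T2 := good (-1) v1 v2 (etrans (sqrrN 1) (expr1n _ 2)) T1 T2.
have eq0 (r : 'M[R]_1) : r + r = 0 -> r = 0.
  by move/eqP; rewrite -mulr2n -scaler_nat scaler_eq0 pnatr_eq0 => /eqP.
have u1 : W1 *m u = 0.
  apply: S1 => v Tv; apply: eq0; have := good2 _ _ Tv Tw2.
  rewrite scaleN1r => /eqP; rewrite subr_eq0 => /eqP E.
  by have := good1 _ _ Tv Tw2; rewrite scale1r -E.
have u2 : W2 *m u = 0.
  apply: S2 => v Tv; apply: eq0; have := good2 _ _ Tw1 Tv.
  rewrite scaleN1r => /eqP; rewrite subr_eq0 => /eqP E.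
  by have := good1 _ _ Tw1 Tv; rewrite scale1r E.
by rewrite -[u]mul1mx -CW mulmxDl -!mulmxA u1 u2 !mulmx0 addr0.
Qed.

(** Each [T i] below kills a common invariant plane. If all are nilpotent, [A i - (a i)%:M] has
    imaginary eigenvalues and its diagonal can be made zero. Otherwise the Fitting idempotent of a
    non-nilpotent [T i] commutes with the family and splits the space, and induction applies to both
    pieces. *)
Lemma commuting_balanced n (A : I -> 'M[R]_n) :
  (forall i j, comm_mx (A i) (A j)) -> balanced A.
Proof.
elim/ltn_ind: n A => n IHn A AC.
have [n0|n_gt0] := posnP n.
  exists 1%:M; last by move=> u _; apply/colP => j; have := ltn_ord j; rewrite {2}n0.
  by split=> [|x /eqP[]]; [rewrite trmx1 | apply/rowP => j; have := ltn_ord j; rewrite {2}n0].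
have [x [y [a [b [xy0 xyA]]]]] := common_invariant_plane n_gt0 AC.
pose T i := (A i - (a i)%:M) *m (A i - (a i)%:M) + (b i ^+ 2)%:M.
have commD (X Y Z : 'M[R]_n) : comm_mx X Y -> comm_mx X Z -> comm_mx X (Y + Z).
  by rewrite /comm_mx mulmxDr mulmxDl => -> ->.
have comm_scalar (X : 'M[R]_n) c : comm_mx X (- c%:M).
  by rewrite /comm_mx mulmxN mulNmx scalar_mxC.
have AC' i j : comm_mx (A i) (A j - (a j)%:M) by apply: commD.
have AT i j : comm_mx (A i) (T j).
  apply: commD; last by rewrite /comm_mx scalar_mxC.
  by rewrite /comm_mx mulmxA AC' -mulmxA AC' mulmxA.
have VT i : col_mx x y *m T i = 0.
  have [xA yA] := xyA i.
  have xB : x *m (A i - (a i)%:M) = - b i *: y.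
    by rewrite mulmxBr xA mul_mx_scalar addrAC subrr add0r scaleNr.
  have yB : y *m (A i - (a i)%:M) = b i *: x.
    by rewrite mulmxBr yA mul_mx_scalar addrK.
  have xT : x *m T i = 0.
    by rewrite mulmxDr mulmxA xB -scalemxAl yB mul_mx_scalar scalerA mulNr -expr2 scaleNr addNr.
  have yT : y *m T i = 0.
    by rewrite mulmxDr mulmxA yB -scalemxAl xB mul_mx_scalar scalerA mulrN -expr2 scaleNr addNr.
  by rewrite mul_col_mx xT yT col_mx0.
have [Tnil|] := pselect (forall i, exists k, T i ^+ k = 0).
  apply: (@balanced_of_diag _ _ a).
  apply: (@diag_free_of_imaginary _ _ (fun i => b i ^+ 2)) => // [i j|i]; last exact: sqr_ge0.
  by apply: commD => //; apply/esym; exact: AC'.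
case/existsNP=> i Tnnil; have [p /= ee [k Tk]] := fitting_idempotent (T i).
set e := \sum_(j < _) _ in ee Tk.
have eA j : comm_mx (A j) e.
  rewrite /comm_mx mulmx_sumr mulmx_suml; apply: eq_bigr => h _.
  rewrite -scalemxAl -scalemxAr; congr (_ *: _).
  exact: (commrX h.+1 (AT j i)).
have e0 : e != 0.
  by apply: contra_not_neq Tnnil => e0; exists k; move: Tk; rewrite e0 subr0 mulmx1.
(* [e] has no constant term in [T i], so it kills the nonzero plane too. *)
have e1 : e != 1%:M.
  apply: contra_neq xy0 => e1; rewrite -[col_mx x y]mulmx1 -e1 mulmx_sumr big1 // => j _.
  by rewrite -scalemxAr exprS -mulmxE mulmxA VT mul0mx scaler0.
have [r [W1 [C1 [CWe WC]]]] : exists r (W1 : 'M[R]_(r, n)) (C1 : 'M[R]_(n, r)),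
    C1 *m W1 = e /\ W1 *m C1 = 1%:M.
  by exists (\rank e), (row_base e), (col_base e); rewrite mulmx_base idempotent_base.
have [m [W2 [C2 [dm [CW WC2 WC12 WC21]]]]] := complete_section WC.
have r_gt0 : (0 < r)%N.
  rewrite lt0n; apply: contra_neq e0 => r0; rewrite -CWe.
  move: W1 C1 {CWe WC CW dm WC12 WC21}; rewrite r0 => W1 C1.
  by rewrite [C1]thinmx0 mul0mx.
have m_gt0 : (0 < m)%N.
  rewrite lt0n; apply: contra_neq e1 => m0; move: CW; rewrite CWe.
  move: W2 C2 {dm WC2 WC12 WC21}; rewrite m0 => W2 C2.
  by rewrite [C2]thinmx0 mul0mx addr0.
have W1e : W1 *m e = W1 by rewrite -CWe mulmxA WC mul1mx.
have eC1 : e *m C1 = C1 by rewrite -CWe -mulmxA WC mulmx1.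
have eC2 : e *m C2 = 0 by rewrite -CWe -mulmxA WC12 mulmx0.
have W2e : W2 *m e = 0 by rewrite -CWe mulmxA WC21 mul0mx.
have A12 j : W1 *m A j *m C2 = 0.
  by rewrite -W1e -(mulmxA W1) -eA mulmxA -mulmxA eC2 mulmx0.
have A21 j : W2 *m A j *m C1 = 0.
  by rewrite -eC1 mulmxA -(mulmxA W2) eA mulmxA W2e !mul0mx.
have C1W1 : C1 *m W1 = 1%:M - C2 *m W2 by rewrite -CW addrK.
have C2W2 : C2 *m W2 = 1%:M - C1 *m W1 by rewrite -CW addrAC subrr add0r.
(* Compression to an invariant summand is multiplicative, so commutation passes to both
   components. *)
have mid q s (W : 'M[R]_(q, n)) (C : 'M[R]_(n, q)) (W' : 'M[R]_(s, n)) (C' : 'M[R]_(n, s)) :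
    C *m W = 1%:M - C' *m W' -> (forall j, W' *m A j *m C = 0) ->
    forall j h, W *m A j *m C *m (W *m A h *m C) = W *m (A j *m A h) *m C.
  move=> CWE A0 j h; rewrite -mulmxA [C *m _]mulmxA [C *m _]mulmxA CWE mulmxBl mul1mx mulmxBl.
  by rewrite -!(mulmxA C') A0 mulmx0 subr0 !mulmxA.
apply: (balanced_split r_gt0 m_gt0 WC CW WC2 WC12 WC21 A12 A21).
  apply: IHn => [|j h]; first by rewrite -dm -{1}[r]addn0 ltn_add2l.
  by rewrite /comm_mx !(mid _ _ _ _ _ _ C1W1) // AC.
apply: IHn => [|j h]; first by rewrite -dm -{1}[m]add0n ltn_add2r.
by rewrite /comm_mx !(mid _ _ _ _ _ _ C2W2) // AC.
Qed.

End CommutingFamilies.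

(** * Solvable Lie algebras *)

Section LieAlgebras.
Variables (R : realType) (n : nat) (br : 'rV[R]_n -> 'rV[R]_n -> 'rV[R]_n).
Hypothesis lie : is_lie_bracket br.
Implicit Types (x y z : 'rV[R]_n) (A B M N Z : 'M[R]_n).

Lemma br_linearr a x y z : br x (a *: y + z) = a *: br x y + br x z.
Proof. by case: lie. Qed.

Lemma br_linearl a x y z : br (a *: x + y) z = a *: br x z + br y z.
Proof. by case: lie. Qed.

Lemma br0r x : br x 0 = 0.
Proof. by have := br_linearr (-1) x 0 0; rewrite scaler0 addr0 scaleN1r addNr. Qed.

Lemma br0l x : br 0 x = 0.
Proof. by have := br_linearl (-1) 0 0 x; rewrite scaler0 addr0 scaleN1r addNr. Qed.

Lemma brDr x y z : br x (y + z) = br x y + br x z.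
Proof. by have := br_linearr 1 x y z; rewrite !scale1r. Qed.

Lemma brDl x y z : br (x + y) z = br x z + br y z.
Proof. by have := br_linearl 1 x y z; rewrite !scale1r. Qed.

Lemma brZr a x y : br x (a *: y) = a *: br x y.
Proof. by have := br_linearr a x y 0; rewrite br0r !addr0. Qed.

Lemma brZl a x y : br (a *: x) y = a *: br x y.
Proof. by have := br_linearl a x 0 y; rewrite br0l !addr0. Qed.

Lemma br_anti x y : br x y = - br y x.
Proof.
have [_ _ alt _] := lie; apply/eqP; rewrite -addr_eq0.
by have := alt (x + y); rewrite brDr !brDl !alt add0r addr0 addrC => ->.
Qed.

Lemma br_jacobi x y z : br (br x y) z = br x (br y z) - br y (br x z).
Proof.
have [_ _ _ jac] := lie; have /eqP := jac x y z.
rewrite (br_anti z (br x y)) subr_eq0 => /eqP <-.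
by rewrite (br_anti z x) -scaleN1r brZr scaleN1r.
Qed.

Lemma br_suml (I : finType) (u : I -> 'rV[R]_n) z :
  br (\sum_i u i) z = \sum_i br (u i) z.
Proof. by apply: (big_morph (br^~ z)) => [x y|]; rewrite ?brDl ?br0l. Qed.

Lemma br_sumr (I : finType) x (u : I -> 'rV[R]_n) :
  br x (\sum_i u i) = \sum_i br x (u i).
Proof. by apply: (big_morph (br x)) => [y z|]; rewrite ?brDr ?br0r. Qed.

Lemma mul_ad_mx y x : y *m ad_mx br x = br x y.
Proof.
rewrite [in RHS](row_sum_delta y) br_sumr mulmx_sum_row; apply: eq_bigr => i _.
by rewrite brZr; congr (_ *: _); apply/rowP => j; rewrite !mxE.
Qed.

Lemma ad_mx_linear a x y : ad_mx br (a *: x + y) = a *: ad_mx br x + ad_mx br y.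
Proof. by apply/matrixP => i j; rewrite !mxE br_linearl !mxE. Qed.

(** Matrices act on row vectors from the right, which reverses the usual order of the commutator. *)
Lemma ad_mx_br x y :
  ad_mx br (br x y) = ad_mx br y *m ad_mx br x - ad_mx br x *m ad_mx br y.
Proof.
apply/row_matrixP => i; rewrite linearB /= !rowE !mulmxA !mul_ad_mx.
exact: br_jacobi.
Qed.

Lemma brsp_in A B x y : (x <= A)%MS -> (y <= B)%MS -> (br x y <= brsp br A B)%MS.
Proof.
move=> /submxP[u ->] /submxP[v ->]; rewrite !mulmx_sum_row br_suml summx_sub // => i _.
rewrite brZl scalemx_sub // br_sumr summx_sub // => j _.
rewrite brZr scalemx_sub // (sumsmx_sup i) // (sumsmx_sup j) //.
by rewrite genmxE.
Qed.

Lemma brsp_min A B p (V : 'M[R]_(p, n)) :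
  (forall x y, (x <= A)%MS -> (y <= B)%MS -> (br x y <= V)%MS) -> (brsp br A B <= V)%MS.
Proof.
move=> H; apply/sumsmx_subP => i _; apply/sumsmx_subP => j _.
by rewrite genmxE H ?row_sub.
Qed.

Lemma brspS A A' B B' : (A <= A')%MS -> (B <= B')%MS -> (brsp br A B <= brsp br A' B')%MS.
Proof.
move=> AA BB; apply: brsp_min => x y xA yB.
by rewrite brsp_in ?(submx_trans xA) ?(submx_trans yB).
Qed.

Lemma brsp_ideal A B : is_ideal br A -> is_ideal br B -> is_ideal br (brsp br A B).
Proof.
move=> idA idB z w wAB; rewrite -mul_ad_mx.
have /submx_trans : (w *m ad_mx br z <= brsp br A B *m ad_mx br z)%MS by rewrite submxMr.
(* The vectors sent into [brsp br A B] by [ad_mx br z] form a kernel, so it is enough to treat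
   brackets [br x y]. *)
apply; rewrite submxE -mulmxA -sub_kermx; apply: brsp_min => x y xA yB.
rewrite sub_kermx mulmxA -submxE mul_ad_mx.
have -> : br z (br x y) = br (br z x) y + br x (br z y) by rewrite br_jacobi subrK.
by rewrite addmx_sub // brsp_in // ?idA ?idB.
Qed.

Lemma ideal1 : is_ideal br 1%:M.
Proof. by move=> x y _; rewrite submx1. Qed.

Lemma derived_ideal k : is_ideal br (derived br k).
Proof. by elim: k => [|k IH]; [exact: ideal1 | exact: brsp_ideal]. Qed.

Lemma ideal_addsmx M N : is_ideal br M -> is_ideal br N -> is_ideal br (M + N)%MS.
Proof.
move=> idM idN x y /sub_addsmxP[u ->]; rewrite brDr.
by rewrite addmx_sub_adds ?idM ?idN ?submxMl.
Qed.

Lemma lcs_ideal M k : is_ideal br M -> is_ideal br (lcs br M k).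
Proof. by move=> idM; elim: k => [|k IH] //; exact: brsp_ideal. Qed.

Lemma lcsS M k : is_ideal br M -> (lcs br M k.+1 <= lcs br M k)%MS.
Proof. by move=> idM; apply: brsp_min => x y _; exact: lcs_ideal. Qed.

Lemma lcs_sub M k : is_ideal br M -> (lcs br M k <= M)%MS.
Proof. by move=> idM; elim: k => [//|k]; exact: submx_trans (lcsS _ _). Qed.

(** A nilpotent ideal of largest rank is maximal for inclusion; the zero ideal shows that there is
    one. *)
Lemma maximal_nilpotent_ideal : exists N, is_nilradical br N.
Proof.
pose P r := `[< exists N, [/\ is_ideal br N, nilpotent_sub br N & \rank N = r] >].
have exP : exists r, P r.
  exists 0%N; apply/asboolP; exists 0; split; rewrite ?mxrank0 //; last by exists 0%N.
  by move=> x y; rewrite submx0 => /eqP->; rewrite br0r sub0mx.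
have bdP r : P r -> (r <= n)%N by move=> /asboolP[N [_ _ <-]]; exact: rank_leq_col.
case: (ex_maxnP exP bdP) => r /asboolP[N [idN nilN rN]] rmax.
exists N; split=> // M idM nilM NM.
rewrite -(geq_leqif (mxrank_leqif_sup NM)) rN; apply: rmax.
by apply/asboolP; exists M.
Qed.

(** The rows of [W] form a basis of the subspace, and [C] reads off coordinates in it. *)
Lemma exists_frame N : exists r (W : 'M[R]_(r, n)) (C : 'M[R]_(n, r)),
  W *m C = 1%:M /\ (W :=: N)%MS.
Proof.
exists (\rank N), (row_base N), (pinvmx (row_base N)).
by split; [exact/mulmxVp/row_base_free | exact: eq_row_base].
Qed.

(** * The adjoint action on an abelian ideal *)

Section Restriction.
Variables (N : 'M[R]_n) (r : nat) (W : 'M[R]_(r, n)) (C : 'M[R]_(n, r)).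
Hypotheses (idN : is_ideal br N) (abN : abelian_sub br N).
Hypotheses (WC : W *m C = 1%:M) (WN : (W :=: N)%MS).

Definition restr x : 'M[R]_r := W *m ad_mx br x *m C.

Lemma frameK p (V : 'M[R]_(p, n)) : (V <= N)%MS -> V *m C *m W = V.
Proof. by rewrite -WN => /submxP[u ->]; rewrite -(mulmxA u) WC mulmx1. Qed.

Lemma frame_sub i : (row i W <= N)%MS.
Proof. by rewrite -WN row_sub. Qed.

Lemma restr_frame x : restr x *m W = W *m ad_mx br x.
Proof.
by apply: frameK; apply/row_subP => i; rewrite row_mul mul_ad_mx idN ?frame_sub.
Qed.

Lemma restr_linear a x y : restr (a *: x + y) = a *: restr x + restr y.
Proof. by rewrite /restr ad_mx_linear mulmxDr mulmxDl -scalemxAr -scalemxAl. Qed.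

Lemma restr_sum_delta x : restr x = \sum_i x 0 i *: restr (delta_mx 0 i).
Proof.
have restr0 : restr 0 = 0.
  by have := restr_linear (-1) 0 0; rewrite scaler0 addr0 scaleN1r addNr.
rewrite {1}(row_sum_delta x) (big_morph restr (id1 := 0) (op1 := +%R)) //.
  by apply: eq_bigr => i _; rewrite -[_ *: delta_mx 0 i]addr0 restr_linear restr0 addr0.
by move=> u v; rewrite -{1}[u]scale1r restr_linear scale1r.
Qed.

Lemma restrM x y : restr x *m restr y = W *m (ad_mx br x *m ad_mx br y) *m C.
Proof. by rewrite [restr y]/restr !mulmxA restr_frame. Qed.

Lemma restr_br x y : restr (br x y) = restr y *m restr x - restr x *m restr y.
Proof. by rewrite !restrM -mulmxBl -mulmxBr -ad_mx_br. Qed.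

Lemma restr_eq0 c : (c <= N)%MS -> restr c = 0.
Proof.
move=> cN; suff WA : W *m ad_mx br c = 0 by rewrite /restr WA mul0mx.
by apply/row_matrixP => i; rewrite row0 row_mul mul_ad_mx abN ?frame_sub.
Qed.

Lemma restr_comm x y : (br x y <= N)%MS -> comm_mx (restr x) (restr y).
Proof.
by move=> /restr_eq0; rewrite restr_br => /eqP; rewrite subr_eq0 => /eqP.
Qed.

(** An endomorphism with image in a subspace has the same trace there as on the whole space. *)
Lemma trace_restr x : (ad_mx br x <= N)%MS -> \tr (restr x) = \tr (ad_mx br x).
Proof. by move=> adN; rewrite /restr -mulmxA mxtrace_mulC frameK. Qed.

(** On a bracket of [y] with [z] in [Z], this is the trace of a commutator times [X]; it vanishes by
    cyclicity since [X] commutes with [restr z]. *)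
Lemma trace_restr_brsp0 (X : 'M[R]_r) Z x :
  (forall z, (z <= Z)%MS -> comm_mx (restr z) X) ->
  (x <= brsp br 1%:M Z)%MS -> \tr (restr x *m X) = 0.
Proof.
(* [f] is the linear form [x |-> \tr (restr x *m X)] as a column, so its kernel is a subspace to
   which [brsp_min] applies. *)
move=> ZX xZ; pose f : 'cV[R]_n := \col_i \tr (restr (delta_mx 0 i) *m X).
have fE y : y *m f = (\tr (restr y *m X))%:M.
  rewrite restr_sum_delta mulmx_suml linear_sum /= [LHS]mx11_scalar mxE; congr (_%:M).
  by apply: eq_bigr => i _; rewrite -scalemxAl linearZ /= mxE.
suff : x *m f = 0.
  by rewrite fE => /matrixP/(_ 0 0); rewrite !mxE mulr1n.
apply/eqP; rewrite -sub_kermx (submx_trans xZ) //; apply: brsp_min => y z _ zZ.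
rewrite sub_kermx fE restr_br mulmxBl linearB /=.
move: (restr y) (restr z) (ZX z zZ) => Y' Z' ZX'.
rewrite -(mulmxA Z') mxtrace_mulC -mulmxA -ZX' (mulmxA Y').
by rewrite subrr raddf0.
Qed.

End Restriction.

(** [M] acts on [N] by commuting matrices, nilpotent by the trace criterion. The lower central
    series of [M + N] stabilizes at some [L] inside [N] with [L] contained in the bracket of [M] and
    [L], so [L = 0]. Thus [M + N] is a nilpotent ideal, and maximality of [N] concludes. *)
Lemma sub_nilradical N M Z : is_nilradical br N -> abelian_sub br N -> is_ideal br M ->
  (forall x y, (x <= M)%MS -> (y <= M)%MS -> (br x y <= N)%MS) ->
  (M <= brsp br 1%:M Z)%MS ->
  (forall z x, (z <= Z)%MS -> (x <= M)%MS -> (br z x <= N)%MS) -> (M <= N)%MS.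
Proof.
move=> [idN _ maxN] abN idM MMN MZ ZMN; have [r [W [C [WC WN]]]] := exists_frame N.
have nilM x : (x <= M)%MS -> exists k, restr W C x ^+ k = 0.
  move=> xM; apply: nilpotent_of_traces => [|j]; first exact: pchar_num.
  (* One factor [restr W C x] uses that [x] is in the bracket of the algebra with [Z]; the other [j]
     form the matrix commuting with the action of [Z]. *)
  rewrite exprS; apply: (trace_restr_brsp0 (Z := Z) idN WC WN); last exact: submx_trans MZ.
  by move=> z zZ; apply: (commrX j); apply: (restr_comm idN abN WC WN); exact: ZMN.
have idK := ideal_addsmx idM idN.
suff nilK : nilpotent_sub br (M + N)%MS.
  by apply: submx_trans (maxN _ idK nilK _); rewrite ?addsmxSl ?addsmxSr.
have [k Lk] := stationary_chain (fun k => lcsS k idK).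
exists k; move: Lk (lcs_sub k idK) => /=; set L := lcs _ _ k => LK LsubK.
have KKN : (brsp br (M + N)%MS (M + N)%MS <= N)%MS.
  apply: brsp_min => _ _ /sub_addsmxP[u ->] /sub_addsmxP[v ->].
  rewrite brDl !brDr; have uN := submxMl u.2 N; have vN := submxMl v.2 N.
  have mm := MMN _ _ (submxMl u.1 M) (submxMl v.1 M).
  have nm : (br (u.2 *m N) (v.1 *m M) <= N)%MS.
    by rewrite br_anti -scaleN1r scalemx_sub ?idN.
  by rewrite !addmx_sub // idN.
have LN : (L <= N)%MS.
  by apply: submx_trans LK (submx_trans (brspS _ _) KKN).
pose L0 := L *m C.
have L0W : L0 *m W = L by exact: (frameK WC WN).
suff L00 : L0 = 0 by rewrite -L0W L00 mul0mx.
apply: (@commuting_nilpotent_eq0 _ _ _ (fun i => restr W C (row i M)) _ _ setT).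
- by move=> i j; apply: (restr_comm idN abN WC WN); apply: MMN; exact: row_sub.
- by move=> i; apply: nilM; exact: row_sub.
set S := (\sum_(i in _) _)%MS.
suff /(submxMr C) : (L <= S *m W)%MS by rewrite -(mulmxA S) WC mulmx1.
apply: submx_trans LK _; apply: brsp_min => _ y /sub_addsmxP[u ->] yL.
(* [L] lies in the abelian [N], so the [N] part of [M + N] acts on it by zero. *)
rewrite brDl (abN (u.2 *m N)) ?submxMl ?(submx_trans yL) // addr0.
rewrite mulmx_sum_row br_suml summx_sub // => i _; rewrite brZl scalemx_sub //.
have Ladj : L *m ad_mx br (row i M) = L0 *m restr W C (row i M) *m W.
  by rewrite -L0W -(mulmxA L0) -(restr_frame idN WC WN) [LHS]mulmxA.
have /submxP[w ->] := yL; rewrite -mul_ad_mx -(mulmxA w) Ladj mulmx_sub // submxMr //.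
by rewrite (sumsmx_sup i) ?inE // genmxE.
Qed.

Lemma derived_sub_nilradical N : is_nilradical br N -> abelian_sub br N ->
  solvable_lie br -> (derived br 1 <= N)%MS.
Proof.
move=> nrN abN [K DK].
have step k : (derived br k.+2 <= N)%MS -> (derived br k.+1 <= N)%MS.
  set D := derived br k.+1 => DDN.
  have idD : is_ideal br D by exact: derived_ideal.
  have DD x y : (x <= D)%MS -> (y <= D)%MS -> (br x y <= N)%MS.
    by move=> xD yD; apply: submx_trans DDN; exact: brsp_in.
  have gDD : (brsp br 1%:M D <= D)%MS by apply: brsp_min => x y _; exact: idD.
  (* First application, with [Z = D]; its conclusion is what allows [Z] to be the whole algebra in
     the second one, for [D] itself. *)
  have gDN : (brsp br 1%:M D <= N)%MS.
    apply: (@sub_nilradical _ _ D) => //; first exact: brsp_ideal ideal1 idD.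
      by move=> x y xM yM; apply: DD; [exact: submx_trans xM gDD | exact: submx_trans yM gDD].
    by move=> z x zD xM; apply: DD => //; exact: submx_trans xM gDD.
  apply: (@sub_nilradical _ _ 1%:M) => //; first by rewrite brspS ?submx1.
  by move=> z x zD xM; apply: submx_trans gDN; exact: brsp_in.
(* The descent only relates positive indices, so it starts at [K.+1] and ends at [1]. *)
have : (derived br K.+1 <= N)%MS.
  rewrite [derived br K.+1]/(brsp br (derived br K) (derived br K)) DK.
  apply: brsp_min => x y; rewrite submx0 => /eqP -> _.
  by rewrite br0l sub0mx.
by elim: K {DK} => // K IH /step.
Qed.

End LieAlgebras.

(** * Construction of the inner product and of the geodesic basis *)

Theorem theorem1p1 (R : realType) (n : nat)
    (br : 'rV[R]_n -> 'rV[R]_n -> 'rV[R]_n) :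
  is_lie_bracket br -> unimodular br -> solvable_lie br ->
  (forall N : 'M[R]_n, is_nilradical br N -> abelian_sub br N) ->
  exists ip : 'rV[R]_n -> 'rV[R]_n -> R,
    is_inner_product ip /\ exists B : 'M[R]_n, geodesic_basis br ip B.
Proof.
move=> lie uni solv nilab.
have [N nrN] := maximal_nilpotent_ideal lie.
have DN := derived_sub_nilradical lie nrN (nilab _ nrN) solv.
set D := derived br 1 in DN.
have brD x y : (br x y <= D)%MS by apply: brsp_in; rewrite ?submx1.
have idD : is_ideal br D by move=> x y _; exact: brD.
have abD : abelian_sub br D.
  by move=> x y xD yD; apply: (nilab N nrN); [exact: submx_trans xD DN | exact: submx_trans yD DN].
have [r [W [C [WC WD]]]] := exists_frame D.
(* The action of basis vectors gives a finite family; linearity recovers every [restr br W C Y] from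
   it. *)
pose A (i : 'I_n) := restr br W C (delta_mx 0 i).
have AC i j : comm_mx (A i) (A j) by exact: (restr_comm lie idD abD WC WD).
have trA i : \tr (A i) = 0.
  rewrite (trace_restr WC WD) ?uni //; apply/row_subP => j.
  by rewrite rowE mul_ad_mx.
have [G [Gsym Gpos] Gspan] := commuting_balanced AC.
have [m [W' [C' [_ [CW W'C' WC' W'C]]]]] := complete_section WC.
(* [G] on [D], the standard product on the complement spanned by [W'], and the two orthogonal. *)
pose ip (x y : 'rV[R]_n) : R := (x *m C *m G *m (y *m C)^T + x *m C' *m (y *m C')^T) 0 0.
have brE x y : exists w, br x y = w *m W.
  by apply/submxP; rewrite WD.
exists ip; split.
  split=> [a x y z|x y|x x0].
  - by rewrite /ip !mulmxDl -!scalemxAl !mxE; ring.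
  - rewrite /ip; have tr00 (X : 'M[R]_1) : X 0 0 = X^T 0 0 by rewrite mxE.
    by rewrite [LHS]tr00 linearD /= !trmx_mul !trmxK !mulmxA Gsym.
  have p1 := Gpos (x *m C); have p2 := @gram_gt0 _ _ (x *m C').
  rewrite /ip mxE; have [xC|xC] := eqVneq (x *m C) 0; last first.
    have [->|xC'] := eqVneq (x *m C') 0; last by rewrite addr_gt0 ?p1 ?p2.
    by rewrite mul0mx [X in _ + X]mxE addr0 p1.
  rewrite xC !mul0mx [X in X + _]mxE add0r p2 //; apply: contra_neq x0 => xC'.
  by rewrite -[x]mulmx1 -CW mulmxDr !mulmxA xC xC' !mul0mx addr0.
pose S v := forall Y, ip v (br v Y) = 0.
have SW' (w : 'rV[R]_m) : S (w *m W').
  move=> Y; have [z ->] := brE (w *m W') Y.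
  have wC : w *m W' *m C = 0 by rewrite -mulmxA W'C mulmx0.
  have zC' : z *m W *m C' = 0 by rewrite -mulmxA WC' mulmx0.
  by rewrite /ip wC zC' !mul0mx trmx0 mulmx0 addr0 mxE.
(* Up to sign, the bracket of [v *m W] with [Y] is the action of [Y] on [v], a combination of the
   trace-zero [A i]. *)
have SW v : trace_vector A G v -> S (v *m W).
  move=> Tv Y; rewrite (br_anti lie) -(mul_ad_mx lie) -(mulmxA v W) -(restr_frame lie idD WC WD).
  have : v *m restr br W C Y *m G *m v^T = 0.
    rewrite restr_sum_delta // mulmx_sumr !mulmx_suml big1 // => i _.
    by rewrite -scalemxAr -!scalemxAl Tv trA raddf0 scaler0.
  move: (restr br W C Y) => B vB.
  have vC : v *m W *m C = v by rewrite -mulmxA WC mulmx1.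
  have vC' : v *m W *m C' = 0 by rewrite -mulmxA WC' mulmx0.
  have vBC : v *m (B *m W) *m C = v *m B by rewrite -!mulmxA WC mulmx1.
  rewrite /ip !mulNmx vC vC' vBC mul0mx addr0.
  have -> : v *m G *m (- (v *m B))^T = - (v *m B *m G *m v^T)^T.
    by rewrite linearN /= mulmxN !trmx_mul trmxK Gsym !mulmxA.
  by rewrite vB trmx0 oppr0 mxE.
have [|B Bfree BS] := @free_rows_in_spanning _ _ S _ n (leqnn n).
  (* Spanning in dual form: a column killed by all geodesic vectors is killed by [W] and by [W'],
     hence is zero. *)
  move=> u Su; rewrite -[u]mul1mx -CW mulmxDl -!mulmxA.
  have -> : W *m u = 0 by apply: Gspan => v /SW/Su; rewrite mulmxA.
  have -> : W' *m u = 0.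
    by apply/row_matrixP => j; rewrite row0 rowE mulmxA; exact: Su (SW' _).
  by rewrite !mulmx0 addr0.
exists B; split=> //.
move=> i; split; last exact: BS.
rewrite rowE mulmx_free_eq0 //; apply/eqP => /matrixP/(_ 0 i)/eqP.
by rewrite !mxE !eqxx oner_eq0.
Qed.
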